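(* For every $t\in\mathbb Z^+\cup\{\infty\}$ and every pair of error measures $(\eta_0,\eta_1)$, $\mathrm{CLI}_t$ is exactly as hard as $\mathrm{BDIS}_t$ with respect to $(\eta_0,\eta_1)$.
   Context: Online problems with binary predictions: an instance is $I=(x,\hat x,r)$, $r=(r_1,\dots,r_n)$ requests, $x,\hat x\in\{0,1\}^n$; requests are revealed one at a time, with $r_i$ the deterministic online algorithm receives prediction $\hat x_i$ and must irrevocably output $y_i\in\{0,1\}$ before the next request; the unrevealed $x$ encodes an optimal solution. $\mathrm{Alg}(I),\mathrm{Opt}(I)$ denote profits. An error-measure pair $(\eta_0,\eta_1)$ assigns to each instance values $0\le\eta_b(I)<\infty$, $\eta_b$ being a function of the incorrectly predicted requests with prediction $b$. For $\alpha,\beta,\gamma\ge0$, an algorithm for a maximization problem is $(\alpha,\beta,\gamma)$-competitive w.r.t. $(\eta_0,\eta_1)$ if there is a constant $b$ with $\mathrm{Opt}(I)\le\alpha\mathrm{Alg}(I)+\beta\eta_0(I)+\gamma\eta_1(I)+b$ for all instances $I$. It is Pareto-optimal if for no $\varepsilon>0$ is there an $(\alpha-\varepsilon,\beta,\gamma)$-, $(\alpha,\beta-\varepsilon,\gamma)$- or $(\alpha,\beta,\gamma-\varepsilon)$-competitive algorithm. $Q$ is as hard as $P$ w.r.t. $(\eta_0,\eta_1)$ if for all $\alpha,\beta,\gamma$, an $(\alpha,\beta,\gamma)$-competitive Pareto-optimal algorithm for $Q$ implies an $(\alpha,\beta,\gamma)$-competitive algorithm for $P$; exactly as hard = both directions.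 Vertex-arrival: request $r_i$ is a new vertex $v_i$ of the input graph $G=(V,E)$ with all its edges to $v_1,\dots,v_{i-1}$. $\mathrm{BDIS}_t$: vertex-arrival, $G$ has maximum degree at most $t$ (no bound if $t=\infty$); $y_i=0$ accepts $v_i$; $\{v_i:x_i=0\}$ is a maximum independent set; profit $\sum_i(1-y_i)$ if accepted vertices are independent, else $-\infty$. $\mathrm{CLI}_t$: vertex-arrival, $G$ satisfies $|V|-t\le\delta(G)$ (minimum degree; no constraint if $t=\infty$); $y_i=0$ adds $v_i$ to the clique; $\{v_i:x_i=0\}$ is a maximum clique; profit $\sum_i(1-y_i)$ if accepted vertices form a clique, else $-\infty$.
   Formalization: The degree condition for CLI_t is corrected from |V|−t ≤ δ(G) to |V|−1−t ≤ δ(G) (complement of maximum degree at most t), since the claim with the original bound fails for t = 2; error measures depend on the arrival positions of the mispredicted requests. *)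

(* Defs.v *)
From HB Require Import structures.
From mathcomp Require Import all_boot all_order all_algebra.
From mathcomp Require Import reals constructive_ereal.

Set Implicit Arguments.
Unset Strict Implicit.
Unset Printing Implicit Defensive.

Import Order.TTheory GRing.Theory Num.Theory.

(* I = (x, xhat, r); requests are numbered from 0, and [false]/[true] stand for
   the bits 0/1. *)
Record instance (Req : Type) := Instance {
  nreq : nat;
  optb : nreq.-tuple bool;
  predb : nreq.-tuple bool;
  reqs : nreq.-tuple Req }.

(* [is_instance] selects the legal instances; in particular it has to require
   that [optb] encodes an optimal solution.  The profit of an output depends on
   the requests only, and is -oo for infeasible outputs. *)
Record max_problem (R : realType) := MaxProblem {
  request : Type;
  is_instance : instance request -> Prop;
  profit : forall n, n.-tuple request -> n.-tuple bool -> \bar R }.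

(* A deterministic online algorithm outputs y_i from the requests and the
   predictions revealed up to and including r_i.  Its own earlier outputs are
   determined by that history, and the total number of requests is unknown. *)
Definition online_alg (Req : Type) := seq (Req * bool) -> bool.

Definition alg_output Req (A : online_alg Req) (I : instance Req) :
    (nreq I).-tuple bool :=
  [tuple A (take i.+1 (zip (reqs I) (predb I))) | i < nreq I].

Definition Alg R (P : max_problem R) (A : online_alg (request P))
    (I : instance (request P)) : \bar R :=
  profit (reqs I) (alg_output A I).

Definition Opt R (P : max_problem R) (I : instance (request P)) : \bar R :=
  \big[maxe/-oo%E]_(y : (nreq I).-tuple bool) profit (reqs I) y.

(* The requests with prediction b that are incorrectly predicted, in order of
   arrival; a request is identified with its number. *)
Definition mispredicted (b : bool) Req (I : instance Req) : seq nat :=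
  [seq val i | i <- enum 'I_(nreq I)
             & (tnth (predb I) i == b) && (tnth (optb I) i != b)].

(* The pair (eta_0, eta_1): eta_b is a function of the incorrectly predicted
   requests with prediction b, so the same pair measures the error on the
   instances of any problem with binary predictions. *)
Record error_pair (R : realType) := ErrorPair {
  err_fun : bool -> seq nat -> R;
  err_fun_ge0 : forall b s, (0 <= err_fun b s)%R }.

Definition err R (eta : error_pair R) (b : bool) Req (I : instance Req) : R :=
  err_fun eta b (mispredicted b I).

Definition competitive R (P : max_problem R) (eta : error_pair R)
    (a b c : R) (A : online_alg (request P)) : Prop :=
  [/\ (0 <= a)%R, (0 <= b)%R, (0 <= c)%R
    & exists k : R, forall I : instance (request P), is_instance I ->
        (Opt I <= a%:E * Alg A I + (b * err eta false I)%:E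
                  + (c * err eta true I)%:E + k%:E)%E].

Definition pareto_optimal R (P : max_problem R) (eta : error_pair R)
    (a b c : R) (A : online_alg (request P)) : Prop :=
  competitive eta a b c A /\
  (forall e : R, (0 < e)%R ->
    [/\ ~ (exists B : online_alg (request P), competitive eta (a - e) b c B),
        ~ (exists B : online_alg (request P), competitive eta a (b - e) c B)
      & ~ (exists B : online_alg (request P), competitive eta a b (c - e) B)]).

Definition as_hard_as R (Q P : max_problem R) (eta : error_pair R) : Prop :=
  forall a b c : R,
    (exists A : online_alg (request Q), pareto_optimal eta a b c A) ->
    exists B : online_alg (request P), competitive eta a b c B.

Definition exactly_as_hard_as R (Q P : max_problem R) (eta : error_pair R) :
    Prop :=
  as_hard_as Q P eta /\ as_hard_as P Q eta.

(* Vertex arrival: the request for vertex j lists, for each earlier vertex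
   i < j, whether ij is an edge. *)
Definition varrival := seq bool.

Definition well_formed n (r : n.-tuple varrival) : bool :=
  [forall j : 'I_n, size (tnth r j) == j].

Definition adj n (r : n.-tuple varrival) : rel 'I_n := fun i j =>
  if i < j then nth false (tnth r j) i
  else if j < i then nth false (tnth r i) j
  else false.

Definition degree n (r : n.-tuple varrival) (i : 'I_n) : nat :=
  #|[set j | adj r i j]|.

Definition max_degree n (r : n.-tuple varrival) : nat :=
  \max_(i < n) degree r i.

(* n exceeds every degree, so it is neutral here unless the graph is empty. *)
Definition min_degree n (r : n.-tuple varrival) : nat :=
  \big[minn/n]_(i < n) degree r i.

Definition independent n (r : n.-tuple varrival) (S : {set 'I_n}) : bool :=
  [forall i in S, forall j in S, ~~ adj r i j].

Definition clique n (r : n.-tuple varrival) (S : {set 'I_n}) : bool :=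
  [forall i in S, forall j in S, (i != j) ==> adj r i j].

Definition maximum_set n (F : pred {set 'I_n}) (S : {set 'I_n}) : Prop :=
  F S /\ forall T : {set 'I_n}, F T -> #|T| <= #|S|.

Definition accepted n (y : n.-tuple bool) : {set 'I_n} :=
  [set i | tnth y i == false].

Definition accept_profit (R : realType) n (F : pred {set 'I_n})
    (y : n.-tuple bool) : \bar R :=
  if F (accepted y) then ((\sum_(i < n) (1 - tnth y i))%:R)%:E else -oo%E.

(* [None] is t = oo. *)
Definition BDIS (R : realType) (t : option nat) : max_problem R :=
  @MaxProblem R varrival
    (fun I => [/\ well_formed (reqs I),
                  (if t is Some k then max_degree (reqs I) <= k else true)
                & maximum_set (independent (reqs I)) (accepted (optb I))])
    (fun n r y => accept_profit R (independent r) y).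

(* The degree constraint is |V| - 1 - t <= delta(G): every vertex is
   non-adjacent to at most t other vertices, i.e. the complement of G has
   maximum degree at most t.  (The bound |V| - t <= delta(G), as found in the
   literature, is off by one: it gives the complements of the graphs of maximum
   degree at most t - 1.) *)
Definition CLI (R : realType) (t : option nat) : max_problem R :=
  @MaxProblem R varrival
    (fun I => [/\ well_formed (reqs I),
                  (if t is Some k then nreq I - 1 - k <= min_degree (reqs I)
                   else true)
                & maximum_set (clique (reqs I)) (accepted (optb I))])
    (fun n r y => accept_profit R (clique r) y).

(* Main.v *)
(** Complementing the graph can be done online, request by request, and turns
    cliques into independent sets and the degree d of a vertex into n - 1 - d.
    It changes neither the bits x and the predictions nor the profit of any
    output, hence no error either, so an algorithm for one problem run on the
    complemented requests has the same guarantee for the other problem. *)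

Require Import Defs.
From mathcomp Require Import all_boot all_order all_algebra.
From mathcomp Require Import reals constructive_ereal.
From mathcomp Require Import zify.

Set Implicit Arguments.
Unset Strict Implicit.
Unset Printing Implicit Defensive.

Definition map_reqs (S T : Type) (f : S -> T) (I : instance S) : instance T :=
  Instance (optb I) (predb I) (map_tuple f (reqs I)).

Definition comap_alg (S T : Type) (f : S -> T) (A : online_alg T) :
    online_alg S :=
  fun s => A [seq (f p.1, p.2) | p <- s].

(** Translating requests commutes with pairing them with predictions and with taking prefixes, so
    both runs see the same history. *)
Lemma alg_output_comap (S T : Type) (f : S -> T) (A : online_alg T)
    (I : instance S) :
  alg_output (comap_alg f A) I = alg_output A (map_reqs f I).
Proof.
apply: eq_from_tnth => i; rewrite !tnth_mktuple /comap_alg map_take /=.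
congr (A (take _ _)).
by elim: (tval (reqs I)) (tval (predb I)) => [|r s IHs] [|b u] //=; rewrite IHs.
Qed.

(** The errors depend only on [optb] and [predb], which [map_reqs] keeps, so the bound for [A] on
    the mapped instance carries over with the same constant [k]. Profits are compared on legal
    instances only, because complementation is shown to preserve them for well-formed requests. *)
Lemma as_hard_as_map (R : realType) (P Q : max_problem R) (eta : error_pair R)
    (f : request P -> request Q) :
  (forall I : instance (request P), is_instance I ->
     is_instance (map_reqs f I)) ->
  (forall I : instance (request P), is_instance I ->
     forall y, profit (map_tuple f (reqs I)) y = profit (reqs I) y) ->
  as_hard_as Q P eta.
Proof.
move=> instf profitf a b c [A [[a0 b0 c0 [k compA]] _]].
exists (comap_alg f A); split=> //; exists k => I instI.
have := compA _ (instf I instI); rewrite /Alg /Opt /= (profitf I instI).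
rewrite alg_output_comap.
by under eq_bigr do rewrite (profitf I instI).
Qed.

Section Complement.
Variable n : nat.
Implicit Types (r : n.-tuple varrival) (i j : 'I_n) (S : {set 'I_n}).

Definition compl_graph r : n.-tuple varrival := map_tuple (map negb) r.

Lemma compl_graphK r : compl_graph (compl_graph r) = r.
Proof.
by apply: eq_from_tnth => i; rewrite !tnth_map (mapK negbK).
Qed.

Lemma well_formed_compl r : well_formed (compl_graph r) = well_formed r.
Proof. by apply: eq_forallb => j; rewrite tnth_map size_map. Qed.

Lemma adj_irr r i : adj r i i = false.
Proof. by rewrite /adj ltnn. Qed.

Lemma adj_compl r i j :
  well_formed r -> adj (compl_graph r) i j = (i != j) && ~~ adj r i j.
Proof.
move=> /forallP wf; rewrite /adj -val_eqE !tnth_map.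
(* Well-formedness puts the index inside the row; beyond its end, the default [false] would survive
   negation. *)
by case: ltngtP => //= lt_ij; rewrite (nth_map false) // (eqP (wf _)).
Qed.

Lemma clique_compl r :
  well_formed r -> clique (compl_graph r) =1 independent r.
Proof.
move=> wf S; apply: eq_forallb => i; congr (_ ==> _).
apply: eq_forallb => j; congr (_ ==> _); rewrite adj_compl //.
(* On the diagonal [clique] demands nothing, and [independent] asks only that there be no loop. *)
by case: eqVneq => //= ->; rewrite adj_irr.
Qed.

Lemma independent_compl r :
  well_formed r -> independent (compl_graph r) =1 clique r.
Proof.
by move=> wf S; rewrite -clique_compl ?well_formed_compl // compl_graphK.
Qed.

(** The neighbours of [i] in the graph and in its complement partition the vertices other than
    [i]. *)
Lemma degree_compl r i :
  well_formed r -> degree r i + degree (compl_graph r) i = n.-1.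
Proof.
move=> wf; rewrite /degree -cardsUI [X in _ + X]eq_card0 => [|j]; last first.
  by rewrite !inE adj_compl // andbCA andbN andbF.
rewrite addn0 -[in RHS](card_ord n) -(cardsC1 i); apply: eq_card => j.
rewrite !inE adj_compl // eq_sym.
by case: eqVneq => [->|_]; rewrite ?adj_irr ?orbN.
Qed.

Lemma max_degree_leP r k :
  reflect (forall i, degree r i <= k) (max_degree r <= k).
Proof. by apply: (iffP (bigmax_leqP _ _ _)) => H i; [apply: H|move=> _]. Qed.

(** The minimum starts from [n], so [k <= n] makes the initial value meet the bound; this settles
    the empty graph. *)
Lemma min_degree_geP r k :
  k <= n -> reflect (forall i, k <= degree r i) (k <= min_degree r).
Proof.
move=> le_kn; rewrite /min_degree (big_morph (leq k) (leq_min k) le_kn).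
by rewrite big_andE; apply: forallP.
Qed.

(** The two bounds agree vertex by vertex, by [degree_compl]. Truncated subtraction is harmless: for
    [k] at least [n - 1] both sides hold. *)
Lemma min_degree_compl r k :
  well_formed r ->
  (n - 1 - k <= min_degree (compl_graph r)) = (max_degree r <= k).
Proof.
move=> wf; apply/min_degree_geP/max_degree_leP => [|le_d i|le_d i].
- by rewrite -subnDA leq_subr.
- by have := le_d i; have := degree_compl i wf; have := ltn_ord i; lia.
- by have := le_d i; have := degree_compl i wf; lia.
Qed.

Lemma max_degree_compl r k :
  well_formed r ->
  (max_degree (compl_graph r) <= k) = (n - 1 - k <= min_degree r).
Proof.
by move=> wf; rewrite -min_degree_compl ?well_formed_compl // compl_graphK.
Qed.

End Complement.

Lemma eq_maximum_set (n : nat) (F G : pred {set 'I_n}) (S : {set 'I_n}) :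
  F =1 G -> maximum_set F S -> maximum_set G S.
Proof. by move=> eqFG [FS maxS]; split=> [|T]; rewrite -eqFG //; apply: maxS. Qed.

Lemma eq_accept_profit (R : realType) (n : nat) (F G : pred {set 'I_n}) :
  F =1 G -> accept_profit R F =1 accept_profit R G.
Proof. by move=> eqFG y; rewrite /accept_profit eqFG. Qed.

Theorem theorem4p15 (R : realType) (t : option nat)
    (ht : forall k : nat, t = Some k -> (0 < k)%N) (eta : error_pair R) :
  exactly_as_hard_as (CLI R t) (BDIS R t) eta.
Proof.
split.
(* Here instances of [BDIS] are complemented and handed to an algorithm for [CLI]; the second half
   swaps the roles. *)
- apply: (@as_hard_as_map _ (BDIS R t) (CLI R t) _ (map negb)) => /= I [wf deg opt].
  + split=> /=; first by rewrite well_formed_compl.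
      by case: t {ht} deg => // k; rewrite min_degree_compl.
    by apply: eq_maximum_set opt => S; rewrite clique_compl.
  + by apply: eq_accept_profit; apply: clique_compl.
- apply: (@as_hard_as_map _ (CLI R t) (BDIS R t) _ (map negb)) => /= I [wf deg opt].
  + split=> /=; first by rewrite well_formed_compl.
      by case: t {ht} deg => // k; rewrite max_degree_compl.
    by apply: eq_maximum_set opt => S; rewrite independent_compl.
  + by apply: eq_accept_profit; apply: independent_compl.
Qed.
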